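(* Let $X$ be a finite non-empty set. Then the free two-sided skew brace of abelian type on $X$ is residually finite.
   Context: A (left) skew brace is a triple $(B,+,\circ)$ with $(B,+)$ and $(B,\circ)$ groups such that $a\circ(b+c)=a\circ b-a+a\circ c$ for all $a,b,c$; it is two-sided if also $(b+c)\circ a=b\circ a-a+c\circ a$, and of abelian type if $(B,+)$ is abelian (such objects are the same as radical rings, with ring product $a*b=-a+a\circ b-b$). The free two-sided skew brace of abelian type on $X$ is the free object on $X$ in the category of two-sided skew braces of abelian type. Put $\lambda_a(b)=-a+a\circ b$. An ideal of $B$ is a subset $I$ that is a normal subgroup of $(B,+)$ and of $(B,\circ)$ with $\lambda_b(I)=I$ for all $b\in B$. $B$ is residually finite if the intersection of all ideals $I$ with $B/I$ finite is $\{0\}$. *)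

(* Defs.v *)
From HB Require Import structures.
From mathcomp Require Import all_boot ssralg.
From mathcomp Require Import boolp classical_sets cardinality.

Set Implicit Arguments.
Unset Strict Implicit.
Unset Printing Implicit Defensive.

Import GRing.Theory.
Local Open Scope classical_set_scope.
Local Open Scope group_scope.
Local Open Scope ring_scope.

(* The circle operation of a skew brace is MathComp's multiplicative group law. *)
Notation "a \circ b" := (a * b)%g (at level 40, left associativity) : ring_scope.

(* BaseZmodule and BaseGroup only provide the operations (0, +, -) and
   (1, \circ, ^-1); the axioms of the two groups are listed here because
   zmodType would force (B, +) to be abelian. *)
HB.mixin Record isSkewBrace B of Algebra.BaseZmodule B & BaseGroup B := {
  sb_addA : associative (@Algebra.add B);
  sb_add0r : left_id (0 : B) (@Algebra.add B);
  sb_addr0 : right_id (0 : B) (@Algebra.add B);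
  sb_addNr : left_inverse (0 : B) (@Algebra.opp B) (@Algebra.add B);
  sb_addrN : right_inverse (0 : B) (@Algebra.opp B) (@Algebra.add B);
  sb_circA : associative (@mul B);
  sb_circ1l : left_id (1%g : B) (@mul B);
  sb_circ1r : right_id (1%g : B) (@mul B);
  sb_circVl : left_inverse (1%g : B) (@inv B) (@mul B);
  sb_circVr : right_inverse (1%g : B) (@inv B) (@mul B);
  sb_circDr : forall a b c : B, a \circ (b + c) = a \circ b - a + a \circ c
}.

#[short(type="skewBraceType")]
HB.structure Definition SkewBrace :=
  {B of isSkewBrace B & Algebra.BaseZmodule B & BaseGroup B}.

HB.mixin Record SkewBrace_isTwoSided B of SkewBrace B := {
  sb_circDl : forall a b c : B, (b + c) \circ a = b \circ a - a + c \circ a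
}.

#[short(type="twoSidedSkewBraceType")]
HB.structure Definition TwoSidedSkewBrace :=
  {B of SkewBrace_isTwoSided B & SkewBrace B}.

(* Being of abelian type amounts to the zmodType structure on (B, +); groupType
   only repeats the axioms of (B, \circ), so that the library applies to it.
   Both come with a choiceType structure, which every type has classically. *)
#[short(type="abelianTwoSidedSkewBraceType")]
HB.structure Definition AbelianTwoSidedSkewBrace :=
  {B of TwoSidedSkewBrace B & GRing.Zmodule B & Group B}.

Definition skew_brace_morphism (B C : skewBraceType) (f : B -> C) : Prop :=
  {morph f : a b / a + b} /\ {morph f : a b / a \circ b}.

Definition is_free_abelian_two_sided (X : Type)
    (B : abelianTwoSidedSkewBraceType) (i : X -> B) : Prop :=
  forall (C : abelianTwoSidedSkewBraceType) (f : X -> C),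
    exists! g : B -> C, skew_brace_morphism g /\ forall x, g (i x) = f x.

Section Ideals.
Variable B : skewBraceType.
Implicit Types (a b x y : B) (I : set B).

Definition lambda a b : B := - a + a \circ b.

Definition add_normal_subgroup I : Prop :=
  [/\ I 0,
      forall x y, I x -> I y -> I (x - y)
    & forall b x, I x -> I (b + x - b)].

Definition circ_normal_subgroup I : Prop :=
  [/\ I 1%g,
      forall x y, I x -> I y -> I (x \circ y^-1%g)
    & forall b x, I x -> I (b \circ x \circ b^-1%g)].

Definition is_ideal I : Prop :=
  [/\ add_normal_subgroup I,
      circ_normal_subgroup I
    & forall b, lambda b @` I = I].

(* The carrier of B / I, as the set of the additive cosets b + I. *)
Definition brace_quotient I : set (set B) :=
  range (fun b => [set b + x | x in I]).

Definition residually_finite : Prop :=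
  \bigcap_(I in [set I | is_ideal I /\ finite_set (brace_quotient I)]) I
    = [set 0].

End Ideals.

(* Main.v *)
Require Import Defs.
From HB Require Import structures.
From mathcomp Require Import all_boot ssralg.
From mathcomp Require Import boolp classical_sets cardinality.
From mathcomp Require Import ssrnum ssrint intdiv zmodp matrix.

(* Regard B as a radical ring with a * b = - a + a \circ b - b.  Every element a
   of B is an integer combination of the unknowns of a linear system
   z = \sum_x x * (A_x z) + \sum_x c_x x with integer coefficients, as such
   elements contain the generators and are closed under -, * and quasi-inverses.
   Formally a is then a noncommutative power series, whose coefficient at a word
   is a product of matrices A_x and a vector c_x.  The combinations of the
   unknowns with zero series form a finitely generated group N, because Z^n is
   noetherian, and N <= B * N because the A_x preserve the vanishing of all
   coefficients; hence N = 0 by Nakayama's lemma.  So a nonzero a has a nonzero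
   coefficient at some word w, and this coefficient modulo a large m is an entry
   of the image of a in the finite radical ring of strictly lower triangular
   matrices over Z/m, of size |w| + 1, where each letter is sent to the sum of
   the elementary matrices at its positions in w. *)

Set Implicit Arguments.
Unset Strict Implicit.
Unset Printing Implicit Defensive.

Import GRing.Theory.
Local Open Scope classical_set_scope.
Local Open Scope ring_scope.

(** * Subgroups, radical rings and the skew braces they define *)

Definition rng_law (V : zmodType) (m : V -> V -> V) : Prop :=
  [/\ associative m, left_distributive m +%R & right_distributive m +%R].

Definition add_subgroup (V : zmodType) (H : set V) : Prop :=
  H 0 /\ forall x y, H x -> H y -> H (x - y).

Lemma add_subgroupN (V : zmodType) (H : set V) x :
  add_subgroup H -> H x -> H (- x).
Proof. by case=> H0 HB Hx; rewrite -[- x]add0r; apply: HB. Qed.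

Lemma add_subgroupD (V : zmodType) (H : set V) x y :
  add_subgroup H -> H x -> H y -> H (x + y).
Proof.
move=> HH Hx Hy; rewrite -[y]opprK; apply: HH.2 => //.
exact: add_subgroupN.
Qed.

Definition additive_of (M N : zmodType) (f : M -> N) (fB : zmod_morphism f) :
    {additive M -> N} :=
  HB.pack f (GRing.isZmodMorphism.Build M N f fB).

HB.factory Record Zmodule_isRadicalRing B of GRing.Zmodule B := {
  rmul : B -> B -> B;
  rqinv : B -> B;
  rmulA : associative rmul;
  rmulDl : left_distributive rmul +%R;
  rmulDr : right_distributive rmul +%R;
  rqinvl : forall a, rqinv a + a + rmul (rqinv a) a = 0;
  rqinvr : forall a, a + rqinv a + rmul a (rqinv a) = 0
}.

HB.builders Context B of Zmodule_isRadicalRing B.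

Let circ (a b : B) : B := a + b + rmul a b.

Let circA : associative circ.
Proof.
move=> a b c; rewrite /circ !rmulDl !rmulDr rmulA.
by rewrite (AC (1*3*3) (1*2*5*3*(6*4*7))).
Qed.

Let circ0l : left_id 0 circ.
Proof.
move=> a; rewrite /circ add0r.
suff -> : rmul 0 a = 0 by rewrite addr0.
by apply: (addIr (rmul 0 a)); rewrite -rmulDl !add0r.
Qed.

Let circ0r : right_id 0 circ.
Proof.
move=> a; rewrite /circ addr0.
suff -> : rmul a 0 = 0 by rewrite addr0.
by apply: (addIr (rmul a 0)); rewrite -rmulDr !add0r.
Qed.

HB.instance Definition _ :=
  isGroup.Build B circA circ0l circ0r rqinvl rqinvr.

Let circDr (a b c : B) : a \circ (b + c) = a \circ b - a + a \circ c.
Proof.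
rewrite {1 2 3}/mul /= /circ rmulDr [_ + - a]addrC !addrA addNr add0r.
by rewrite (ACl (2*4*1*3*5)).
Qed.

Let circDl (a b c : B) : (b + c) \circ a = b \circ a - a + c \circ a.
Proof.
rewrite {1 2 3}/mul /= /circ rmulDl [b + _ + _ - _]addrAC addrK.
by rewrite (AC (2*1*2) (1*4*(2*3*5))).
Qed.

HB.instance Definition _ := isSkewBrace.Build B (@addrA B) (@add0r B)
  (@addr0 B) (@addNr B) (@addrN B) (@mulgA B) (@mul1g B) (@mulg1 B)
  (@mulVg B) (@mulgV B) circDr.

HB.instance Definition _ := SkewBrace_isTwoSided.Build B circDl.

HB.end.

(** Serves twice: for subbraces of a given brace and for strictly triangular matrices.
    Quasi-inverses are asked for inside [P] only, so [m] may be the product of a ring that is not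
    radical. *)
Lemma sub_brace (V : zmodType) (m : V -> V -> V) (P : set V) :
    rng_law m -> add_subgroup P ->
    (forall x y, P x -> P y -> P (m x y)) ->
    (forall x, P x -> exists y,
       [/\ P y, y + x + m y x = 0 & x + y + m x y = 0]) ->
  exists (C : abelianTwoSidedSkewBraceType) (v : {additive C -> V}),
    [/\ injective v,
        forall a b, v (a \circ b) = v a + v b + m (v a) (v b) &
        range v = P].
Proof.
move=> [mA mDl mDr] HP PM Pq.
pose T := {x : V | `[<P x >]}.
have TP (a : T) : P (val a) by case: a => x /= /asboolP.
pose mk x (Px : P x) : T := exist _ x (asboolT Px).
pose zT : T := mk 0 HP.1.
pose oT (a : T) : T := mk _ (add_subgroupN HP (TP a)).
pose aT (a b : T) : T := mk _ (add_subgroupD HP (TP a) (TP b)).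
have aA : associative aT by move=> a b c; apply: val_inj; rewrite /= addrA.
have aC : commutative aT by move=> a b; apply: val_inj; rewrite /= addrC.
have a0 : left_id zT aT by move=> a; apply: val_inj; rewrite /= add0r.
have aN : left_inverse zT oT aT by move=> a; apply: val_inj; rewrite /= addNr.
pose Z : zmodType := HB.pack T (GRing.isZmodule.Build T aA aC a0 aN).
pose mT (a b : Z) : Z := mk _ (PM _ _ (TP a) (TP b)).
pose qT (a : Z) : Z := mk _ (let: And3 h _ _ := svalP (cid (Pq _ (TP a))) in h).
have mTA : associative mT by move=> a b c; apply: val_inj; rewrite /= mA.
have mTl : left_distributive mT +%R.
  by move=> a b c; apply: val_inj; rewrite /= mDl.
have mTr : right_distributive mT +%R.
  by move=> a b c; apply: val_inj; rewrite /= mDr.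
have ql a : qT a + a + mT (qT a) a = 0.
  by apply: val_inj; rewrite /=; case: cid => b [].
have qr a : a + qT a + mT a (qT a) = 0.
  by apply: val_inj; rewrite /=; case: cid => b [].
pose C : abelianTwoSidedSkewBraceType := HB.pack (Z : Type) Z
  (Zmodule_isRadicalRing.Build Z mTA mTl mTr ql qr).
have valB : zmod_morphism (val : C -> V) by [].
exists C, (additive_of valB); split=> //; first exact: val_inj.
apply/seteqP; split=> [_ [a _ <-]|x Px]; first exact: TP.
by exists (mk x Px).
Qed.

(** * The radical ring of a brace *)

HB.lock Definition smul (B : abelianTwoSidedSkewBraceType) (a b : B) : B :=
  lambda a b - b.
Arguments smul {B} a b.

Section RadicalRing.
Variable B : abelianTwoSidedSkewBraceType.
Implicit Types a b c : B.

Lemma circE a b : a \circ b = a + b + smul a b.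
Proof.
by rewrite smul.unlock /lambda [_ - b]addrC addrA addrK addrA addrN add0r.
Qed.

(** Distributivity at [b = c = 0] reads [a \circ 0 = a \circ 0 - a + a \circ 0]; cancel on the
    left. *)
Lemma circr0 a : a \circ 0 = a.
Proof.
have := sb_circDr a 0 0; rewrite addr0 -addrA -[LHS]addr0.
by move/addrI/esym/eqP; rewrite addrC subr_eq0 => /eqP.
Qed.

Lemma circ1E : 1%g = 0 :> B.
Proof. by rewrite -[LHS]circr0 mul1g. Qed.

Lemma smulVr a : a + a^-1%g + smul a a^-1%g = 0.
Proof. by rewrite -circE mulgV circ1E. Qed.

Lemma smulVl a : a^-1%g + a + smul a^-1%g a = 0.
Proof. by rewrite -circE mulVg circ1E. Qed.

Lemma smulDr a : {morph smul a : b c / b + c}.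
Proof.
move=> b c; rewrite smul.unlock /lambda sb_circDr opprD !addrA.
by rewrite (ACl (1*2*5*3*4*6)).
Qed.

Lemma smulDl c : {morph smul^~ c : a b / a + b}.
Proof.
move=> a b; rewrite smul.unlock /lambda sb_circDl opprD !addrA.
by rewrite (ACl (1*3*4*2*5*6)).
Qed.

Fact smul_zmod_morphism a : zmod_morphism (smul a).
Proof.
move=> b c; apply: (addIr (smul a c)).
by rewrite -smulDr !subrK.
Qed.

HB.instance Definition _ a :=
  GRing.isZmodMorphism.Build B B (smul a) (smul_zmod_morphism a).

Lemma smulBl c : {morph smul^~ c : a b / a - b}.
Proof.
move=> a b; apply: (addIr (smul b c)).
by rewrite -smulDl !subrK.
Qed.

(** Flipped product, whose additive structure gives the [raddf] lemmas in the left factor. *)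
Definition smulr b a : B := smul a b.

HB.instance Definition _ b :=
  GRing.isZmodMorphism.Build B B (smulr b) (smulBl b).

Lemma smul0l b : smul 0 b = 0.
Proof. exact: (raddf0 (smulr b)). Qed.

Lemma smulNl b : {morph smul^~ b : a / - a}.
Proof. exact: (raddfN (smulr b)). Qed.

Lemma smulMzl b a n : smul (a *~ n) b = smul a b *~ n.
Proof. exact: (raddfMz (smulr b)). Qed.

Lemma smul_suml (I : finType) (F : I -> B) b :
  smul (\sum_i F i) b = \sum_i smul (F i) b.
Proof. by rewrite -[LHS]/(smulr b _) raddf_sum. Qed.

(** Expand both sides of the associativity of the circle operation: all terms but the triple
    products cancel. *)
Lemma smulA : associative (@smul B).
Proof.
move=> a b c; have := mulgA a b c; rewrite !circE !smulDr !smulDl.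
by rewrite (AC (1*3*3) (1*2*5*3*(6*4*7))) => /addrI/addrI.
Qed.

Lemma smul_rng_law : rng_law (@smul B).
Proof.
by split=> [|a b c|a b c]; [exact: smulA|exact: smulDl|exact: smulDr].
Qed.

End RadicalRing.

(** * Noetherian abelian groups *)

(** That [s] generates [K] is stated as minimality among the subgroups containing [s], which then
    serves as an induction principle on [K]. *)
Definition noetherian (M : zmodType) : Prop :=
  forall K : set M, add_subgroup K ->
  exists s : seq M, (forall y, y \in s -> K y) /\
    forall H, add_subgroup H -> (forall y, y \in s -> H y) -> K `<=` H.

Lemma noetherian_int : noetherian int.
Proof.
move=> K KK.
have [[n Kn]|noK] := pselect (exists n : nat, K n.+1%:Z); last first.
  exists [::]; split=> // H [H0 _] _ k Kk.
  suff -> : k = 0 by [].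
  case: k Kk => [[//|n] Kn|n Kn]; first by case: noK; exists n.
  by case: noK; exists n; rewrite -[_%:Z]opprK -NegzE; apply: add_subgroupN.
have ex : exists n, `[< K n.+1%:Z >] by exists n; apply/asboolP.
(* The generator is the least positive element [d.+1] of [K]. *)
case: (ex_minnP ex) => d /asboolP Kd dmin.
have mulH (H : set int) z k : add_subgroup H -> H z -> H (z *~ k).
  move=> HH Hz; have nat_case n' : H (z *+ n').
    elim: n' => [|n' IH]; first by case: HH.
    by rewrite mulrS; apply: add_subgroupD.
  case: k => n'; first exact: nat_case.
  by rewrite NegzE mulrNz; apply: (add_subgroupN HH (nat_case _)).
exists [:: d.+1%:Z]; split=> [y|H HH Hd k Kk]; first by rewrite inE => /eqP ->.
have {}Hd : H d.+1%:Z by apply: Hd; rewrite inE.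
have dk : k = d.+1%:Z *~ (k %/ d.+1%:Z)%Z + (k %% d.+1%:Z)%Z.
  by rewrite [LHS](divz_eq k d.+1%:Z) -mulrzr intz mulrC.
rewrite dk; suff -> : (k %% d.+1%:Z)%Z = 0 by rewrite addr0; apply: mulH.
have Kr : K (k %% d.+1%:Z)%Z.
  have -> : (k %% d.+1%:Z)%Z = k - d.+1%:Z *~ (k %/ d.+1%:Z)%Z.
    by rewrite {2}dk addrC addKr.
  by apply: KK.2 => //; apply: mulH.
have := ltz_pmod k (isT : 0 < d.+1%:Z); have := modz_ge0 k (isT : d.+1%:Z != 0).
case: (k %% d.+1%:Z)%Z Kr => [[//|r] Kr _ |//].
(* A nonzero remainder is [r.+1] with [r < d], against the minimality of [d]. *)
rewrite ltz_nat ltnNge ltnS => /negP[]; apply: dmin; exact/asboolP.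
Qed.

(* A generating set of K consists of lifts of generators of the first projection
   of K, and of generators of the kernel of that projection. *)
Lemma noetherian_prod (M N : zmodType) :
  noetherian M -> noetherian N -> noetherian (M * N)%type.
Proof.
move=> nM nN K KK.
pose K1 := [set m | exists n, K (m, n)].
pose K2 := [set n | K (0, n)].
have [|s1 [sK1 s1min]] := nM K1.
  split=> [|x y [n Kn] [n' Kn']]; first by exists 0; apply: KK.1.
  by exists (n - n'); apply: (KK.2 _ _ Kn Kn').
have [|s2 [sK2 s2min]] := nN K2.
  split=> [|x y Kx Ky]; first exact: KK.1.
  by have := KK.2 _ _ Kx Ky; rewrite /K2 /= /GRing.add /= /add_pair /= subr0.
have [t [tK ts1]] : exists t : seq (M * N),
    (forall p, p \in t -> K p) /\ [seq p.1 | p <- t] = s1.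
  elim: s1 sK1 {s1min} => [|m s IH] sK; first by exists [::].
  have [|t [tK <-]] := IH; first by move=> y ys; apply: sK; rewrite inE ys orbT.
  have [|n Kn] := sK m; first by rewrite inE eqxx.
  by exists ((m, n) :: t); split=> // p; rewrite inE => /predU1P[->|/tK].
exists (t ++ [seq (0, n) | n <- s2]); split=> [p|H HH Hs].
  by rewrite mem_cat => /orP[/tK//|/mapP[n /sK2 Kn ->]].
have H2 : K2 `<=` [set n | H (0, n)].
  apply: s2min => [|n ns2]; last by apply: Hs; rewrite mem_cat map_f ?orbT.
  split=> [|x y Hx Hy]; first exact: HH.1.
  by have := HH.2 _ _ Hx Hy; rewrite /= /GRing.add /= /add_pair /= subr0.
have H1 : K1 `<=` [set m | exists n, H (m, n) /\ K (m, n)].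
  apply: s1min => [|m].
    split=> [|x y [n [Hn Kn]] [n' [Hn' Kn']]].
      by exists 0; split; [apply: HH.1|apply: KK.1].
    exists (n - n').
    by split; [apply: (HH.2 _ _ Hn Hn')|apply: (KK.2 _ _ Kn Kn')].
  rewrite -ts1 => /mapP[[m' n] pt ->]; exists n; split; last exact: tK.
  by apply: Hs; rewrite mem_cat pt.
case=> m n Kmn; have [|n' [Hn' Kn']] := H1 m; first by exists n.
have E x : (m, x) - (m, n') = (0, x - n') by congr pair; rewrite /= subrr.
rewrite -[(m, n)](subrK (m, n')); apply: add_subgroupD => //.
by rewrite E; apply: H2; rewrite /K2 /= -E; apply: KK.2.
Qed.

(** * Induction on the free brace *)

(** The universal map to the subbrace on [P], followed by the inclusion, is an endomorphism of [B]
    fixing the generators. By uniqueness it is the identity, so [P] is all of [B]. *)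
Lemma free_brace_ind (X : Type) (B : abelianTwoSidedSkewBraceType) (i : X -> B)
    (P : set B) :
    is_free_abelian_two_sided i -> add_subgroup P ->
    (forall a b, P a -> P b -> P (smul a b)) ->
    (forall a, P a -> P a^-1%g) -> (forall x, P (i x)) ->
  forall a, P a.
Proof.
move=> free_i PP PM PV Pi a.
have [a0 Pa0|C [v [v_inj vcirc rangev]]] := sub_brace (smul_rng_law B) PP PM.
  by exists a0^-1%g; rewrite smulVl smulVr; split=> //; apply: PV.
have liftP x : exists y, v y = i x.
  have : range v (i x) by rewrite rangev.
  by case=> y _ <-; exists y.
have [g [[[gD gM] gi] _]] := free_i C (fun x => sval (cid (liftP x))).
have [h [_ huniq]] := free_i B i.
have hid : h = id by apply: huniq; split.
have hvg : h = v \o g.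
  apply: huniq; split; last by move=> x; rewrite /= gi; case: cid.
  by split=> b c; rewrite /= ?gD ?raddfD// gM vcirc circE.
have <- : v (g a) = a by have := congr1 (@^~ a) (etrans (esym hvg) hid).
by rewrite -rangev; exists (g a).
Qed.

(** * Nakayama's lemma *)

Section Nakayama.
Variable B : abelianTwoSidedSkewBraceType.
Implicit Types (s : seq B) (b x y : B).

(** The left ideal [B * s], with coefficients in [B] and not in [Z + B], so it need not contain the
    elements of [s]. *)
Fixpoint lspan s y : Prop :=
  if s is x :: s' then exists b, lspan s' (y - smul b x) else y = 0.

Lemma lspan_subgroup s : add_subgroup (lspan s).
Proof.
elim: s => [|x s [IH0 IHB]]; first by split=> //= y z -> ->; rewrite subr0.
split=> [|y z [b Hb] [c Hc]] /=.
  by exists 0; rewrite smul0l subr0.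
exists (b - c); rewrite smulBl.
suff -> : y - z - (smul b x - smul c x) = y - smul b x - (z - smul c x).
  exact: IHB.
by rewrite !opprD !opprK addrACA.
Qed.

Lemma lspanM s b y : lspan s y -> lspan s (smul b y).
Proof.
elim: s y => [|x s IH] y /=; first by move->; rewrite raddf0.
by case=> c /IH H; exists (smul b c); rewrite -smulA -raddfB.
Qed.

Lemma lspan_gen s b x : x \in s -> lspan s (smul b x).
Proof.
elim: s => [//|y s IH]; rewrite inE => /predU1P[->|xs] /=.
  by exists b; rewrite subrr; apply: (lspan_subgroup s).1.
by exists 0; rewrite smul0l subr0; apply: IH.
Qed.

Lemma lspan_eq0 s y : (forall x, x \in s -> x = 0) -> lspan s y -> y = 0.
Proof.
elim: s y => [//|x s IH] y s0 /= [b].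
rewrite (s0 x) ?inE ?eqxx// raddf0 subr0; apply: IH => z zs.
by apply: s0; rewrite inE zs orbT.
Qed.

(* The first generator is x = b * x + l with l in the span of the others, and
   1 - b is invertible, so x lies in that span. *)
Lemma nakayama s :
  (forall y, y \in s -> lspan s y) -> forall y, y \in s -> y = 0.
Proof.
elim: s => [//|x s IH] Hs.
have [b Hb] : lspan (x :: s) x by apply: Hs; rewrite inE eqxx.
have Hx : lspan s x.
  (* With [c] the circle inverse of [- b], formally [(1 + c) * (1 - b) = 1]. *)
  have -> : x = (x - smul b x) + smul (- b)^-1%g (x - smul b x).
    rewrite (raddfB (smul _)) /= smulA.
    have := smulVl (- b); set c := (- b)^-1%g.
    rewrite (raddfN (smul c)) => /(congr1 (fun y => smul y x)).
    rewrite smul0l smulBl smulBl => E.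
    by rewrite -addrA [- _ + _]addrA [- _ + _]addrC E addr0.
  by apply: add_subgroupD (lspanM _ _) => //; apply: lspan_subgroup.
have s0 : forall y, y \in s -> y = 0.
  apply: IH => y ys; have [|c Hc] := Hs y; first by rewrite inE ys orbT.
  rewrite -[y](subrK (smul c x)).
  by apply: add_subgroupD (lspanM _ _) => //; apply: lspan_subgroup.
by move=> y; rewrite inE => /predU1P[->|/s0//]; apply: lspan_eq0 Hx.
Qed.

End Nakayama.

(** * Rational elements and their power series *)

Section Automata.
Variables (X : finType) (B : abelianTwoSidedSkewBraceType) (i : X -> B).

(* The system is indexed by a group M of formal combinations of the unknowns,
   theta being the evaluation at the solution. *)
Definition realizes (M : zmodType) (A : X -> {additive M -> M})
    (c : X -> {additive M -> int}) (theta : {additive M -> B}) : Prop :=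
  forall k, theta k = \sum_x (smul (i x) (theta (A x k)) + i x *~ c x k).

Definition rational (a : B) : Prop :=
  exists (M : zmodType) (A : X -> {additive M -> M})
    (c : X -> {additive M -> int}) (theta : {additive M -> B}) (k : M),
    [/\ noetherian M, realizes A c theta & a = theta k].

(** The system has one unknown, [z = i x]: all [A] vanish and only [c x] is nonzero. *)
Lemma rational_gen x : rational (i x).
Proof.
have thB : zmod_morphism (fun k : int => i x *~ k).
  by move=> k l; rewrite mulrzBr.
have cB y : zmod_morphism (fun k : int => k *+ (x == y)).
  by move=> k l; rewrite mulrnBl.
have AB : zmod_morphism (fun k : int => 0 : int) by move=> k l; rewrite subr0.
exists int, (fun=> additive_of AB), (fun y => additive_of (cB y)).
exists (additive_of thB), 1.
split; [exact: noetherian_int| |by rewrite /= mulr1z].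
move=> k /=; rewrite (bigD1 x)//= mulr0z raddf0 add0r eqxx mulr1n big1 ?addr0//.
by move=> y /negPf; rewrite eq_sym => ->; rewrite !mulr0z raddf0 addr0.
Qed.

(** The two systems are put side by side. *)
Lemma rationalB a b : rational a -> rational b -> rational (a - b).
Proof.
move=> [M [A [c [th [k [nM real_th ->]]]]]].
move=> [N [A' [c' [th' [k' [nN real_th' ->]]]]]].
have AB x : zmod_morphism (fun p : M * N => (A x p.1, A' x p.2)).
  by move=> p q; rewrite /= !raddfB.
have cB x : zmod_morphism (fun p : M * N => c x p.1 + c' x p.2).
  by move=> p q; rewrite /= !raddfB opprD addrACA.
have thB : zmod_morphism (fun p : M * N => th p.1 + th' p.2).
  by move=> p q; rewrite /= !raddfB opprD addrACA.
exists (M * N)%type, (fun x => additive_of (AB x)).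
exists (fun x => additive_of (cB x)), (additive_of thB), (k, - k').
split; [exact: noetherian_prod| |by rewrite /= raddfN].
move=> p /=; rewrite {1}real_th {1}real_th' -big_split.
apply: eq_bigr => x _ /=.
by rewrite raddfD mulrzDr addrACA.
Qed.

(* If b = theta' k', the unknowns are z * b and z', and each term x * b in the
   equation of z * b equals x * theta' k'. *)
Lemma rationalM a b : rational a -> rational b -> rational (smul a b).
Proof.
move=> [M [A [c [th [k [nM real_th ->]]]]]].
move=> [N [A' [c' [th' [k' [nN real_th' ->]]]]]].
set b' := th' k'.
have AB x : zmod_morphism
    (fun p : M * N => (A x p.1, A' x p.2 + k' *~ c x p.1)).
  move=> p q; congr pair; first by rewrite /= raddfB.
  by rewrite /= !raddfB opprD addrACA.
have cB x : zmod_morphism (fun p : M * N => c' x p.2).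
  by move=> p q; rewrite /= !raddfB.
have thB : zmod_morphism (fun p : M * N => smul (th p.1) b' + th' p.2).
  by move=> p q; rewrite /= !raddfB smulBl opprD addrACA.
exists (M * N)%type, (fun x => additive_of (AB x)).
exists (fun x => additive_of (cB x)), (additive_of thB), (k, 0).
split; [exact: noetherian_prod| |by rewrite /= raddf0 addr0].
move=> p /=; rewrite {1}real_th {1}real_th' smul_suml -big_split.
apply: eq_bigr => x _ /=.
rewrite smulDl smulMzl -smulA !raddfD !raddfMz -/b' !addrA.
by rewrite (ACl (1*3*2*4)).
Qed.

(* With b the quasi-inverse of a = theta k0, the new unknowns are z + z * b. *)
Lemma rationalV a : rational a -> rational a^-1%g.
Proof.
move=> [M [A [c [th [k0 [nM real_th Ea]]]]]]; set b := a^-1%g.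
have AB x : zmod_morphism (fun k => A x k - k0 *~ c x k).
  by move=> p q; rewrite /= !raddfB addrACA.
have thB : zmod_morphism (fun k => th k + smul (th k) b).
  by move=> p q; rewrite /= !raddfB smulBl opprD addrACA.
have bE : b = - (th k0 + smul (th k0) b).
  by rewrite -Ea; apply/eqP; rewrite -addr_eq0 addrA [b + a]addrC smulVr.
exists M, (fun x => additive_of (AB x)), c, (additive_of thB), (- k0).
split=> //; last by rewrite /= raddfN smulNl -opprD.
move=> k /=; rewrite {1 2}real_th smul_suml -big_split.
apply: eq_bigr => x _ /=.
have -> : th (A x k - k0 *~ c x k) + smul (th (A x k - k0 *~ c x k)) b
    = th (A x k) + smul (th (A x k)) b + b *~ c x k.
  have := thB (A x k) (k0 *~ c x k) => /= ->.
  by rewrite raddfMz smulMzl -mulrzDl -mulNrz -bE.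
rewrite smulDl smulMzl -smulA !raddfD !raddfMz.
by rewrite !addrA (ACl (1*3*4*2)).
Qed.

(** Coefficient at [w] of the series of [k]: the letters act through [A] from the left, except that
    the last acts through [c], which [nilp] singles out. There is no constant term. *)
Fixpoint coef (M : zmodType) (A : X -> {additive M -> M})
    (c : X -> {additive M -> int}) (w : seq X) (k : M) : int :=
  if w is x :: w' then coef A c w' (A x k) + c x k *+ nilp w' else 0.

Lemma coefB (M : zmodType) A c w : zmod_morphism (@coef M A c w).
Proof.
elim: w => [|x w IH] k l; first by rewrite subr0.
by rewrite /= !raddfB IH mulrnBl opprD addrACA.
Qed.

Lemma realizes_eq0 (M : zmodType) A c (theta : {additive M -> B}) k :
    noetherian M -> realizes A c theta -> (forall w, @coef M A c w k = 0) ->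
  theta k = 0.
Proof.
move=> nM real_th; pose K := [set k | forall w, @coef M A c w k = 0].
have KK : add_subgroup K.
  split=> [w|x y Kx Ky w]; last by rewrite coefB Kx Ky subr0.
  by rewrite -[0 in LHS](subrr 0) coefB subrr.
have KA x l : K l -> K (A x l).
  (* The coefficient of [A x l] at [y :: w] is that of [l] at [x :: y :: w]. *)
  by move=> Kl [//|y w]; have := Kl [:: x, y & w]; rewrite /= mulr0n addr0.
have Kc x l : K l -> c x l = 0.
  by move=> Kl; have := Kl [:: x]; rewrite /= add0r mulr1n.
have [s [sK smin]] := nM K KK.
(* The condition is additive in [l] and clear on the generators [s], hence holds on [K]. *)
have Kspan : K `<=` [set l | forall b, lspan (map theta s) (smul b (theta l))].
  apply: smin => [|y ys b]; last by apply: lspan_gen; apply: map_f.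
  split=> [b|x y Hx Hy b].
    by rewrite !raddf0; apply: (lspan_subgroup _).1.
  by rewrite !raddfB; apply: (lspan_subgroup _).2; [apply: Hx|apply: Hy].
have Kker : K `<=` [set l | theta l = 0].
  apply: smin => [|y ys].
    by split=> [|x y /= Hx Hy] /=; rewrite ?raddf0// raddfB Hx Hy subr0.
  apply: (@nakayama B (map theta s)); last exact: map_f.
  move=> _ /mapP[l ls ->]; rewrite real_th.
  (* As [c x l = 0], every summand is [i x] times [theta (A x l)] with [A x l] in [K]. *)
  have Kl := sK l ls; elim/big_ind: _ => [|u v|x _].
  - exact: (lspan_subgroup _).1.
  - by apply: add_subgroupD; apply: lspan_subgroup.
  - by rewrite Kc// mulr0z addr0; apply: Kspan; apply: KA.
exact: Kker.
Qed.

Lemma free_rational : (0 < #|X|)%N -> is_free_abelian_two_sided i ->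
  forall a, rational a.
Proof.
case/card_gt0P=> x _ free_i; apply: (free_brace_ind free_i).
- split; last exact: rationalB.
  (* Zero is rational as the difference of a generator with itself. *)
  by rewrite -(subrr (i x)); apply: rationalB; apply: rational_gen.
- exact: rationalM.
- exact: rationalV.
- exact: rational_gen.
Qed.

End Automata.

(** * The radical ring of strictly lower triangular matrices *)

Section StrictlyTriangular.
Variables (R : comUnitRingType) (n : nat).
Implicit Types a b : 'M[R]_n.

Definition strict_trig : set 'M[R]_n :=
  [set a | forall p q : 'I_n, (p <= q)%N -> a p q = 0].

Lemma strict_trig_subgroup : add_subgroup strict_trig.
Proof.
split=> [p q _|a b Ha Hb p q pq]; first by rewrite mxE.
by rewrite !mxE Ha// Hb// subr0.
Qed.

Lemma strict_trigM a b : strict_trig a -> strict_trig b -> strict_trig (a *m b).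
Proof.
move=> Ha Hb p q pq; rewrite mxE big1// => j _.
have [pj|jp] := leqP p j; first by rewrite Ha// mul0r.
by rewrite Hb ?mulr0// (leq_trans (ltnW jp)).
Qed.

(** The matrix [1 + a] has determinant 1, and [b] is its inverse minus 1. *)
Lemma strict_trigV a : strict_trig a ->
  exists b, [/\ strict_trig b, b + a + b *m a = 0 & a + b + a *m b = 0].
Proof.
move=> Ha; pose u := 1%:M + a.
have u_unit : u \in unitmx.
  have u_trig : is_trig_mx u.
    apply/is_trig_mxP => p q pq; rewrite !mxE Ha 1?ltnW// addr0.
    by case: eqVneq pq => // ->; rewrite ltnn.
  rewrite unitmxE det_trig// big1 ?unitr1// => p _.
  by rewrite !mxE eqxx Ha// addr0.
have [b bE] : exists b, b = invmx u - 1%:M by exists (invmx u - 1%:M).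
have abE : a + b + a *m b = 0.
  have -> : a + b + a *m b = a + u *m b by rewrite mulmxDl mul1mx addrA.
  by rewrite bE mulmxBr mulmxV// mulmx1 addrA [a + _]addrC subrr.
have baE : b + a + b *m a = 0.
  have -> : b + a + b *m a = a + b *m u.
    by rewrite mulmxDr mulmx1 addrA [b + a]addrC.
  by rewrite bE mulmxBl mulVmx// mul1mx addrA [a + _]addrC subrr.
(* Induction on the row: [b = - a - a *m b], and row [p] of [a *m b] involves only rows of [b] above
   [p]. *)
exists b; split=> // p; have [d] := ubnP (p : nat).
elim: d p => // d IH p pd q pq.
have /matrixP/(_ p q) := abE; rewrite ![in LHS]mxE Ha// add0r.
rewrite [X in _ + X]big1 ?addr0 ?[in RHS]mxE// => j _.
have [pj|jp] := leqP p j; first by rewrite Ha// mul0r.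
rewrite IH ?mulr0//; first by rewrite (leq_trans jp).
by rewrite (leq_trans (ltnW jp)).
Qed.

End StrictlyTriangular.

(** * Kernels of brace morphisms *)

Section MorphismKernel.
Variables (B C : abelianTwoSidedSkewBraceType) (g : B -> C).
Hypothesis g_morph : skew_brace_morphism g.

Lemma morphism_zmod : zmod_morphism g.
Proof.
by move=> a b; apply: (addIr (g b)); rewrite -g_morph.1 !subrK.
Qed.

Let gD := g_morph.1.
Let gM := g_morph.2.

Let g0 : g 0 = 0.
Proof. exact: (raddf0 (additive_of morphism_zmod)). Qed.

Let gV a : g a^-1%g = (g a)^-1%g.
Proof. by apply: (mulgI (g a)); rewrite -gM !mulgV !circ1E. Qed.

Lemma kernel_ideal : is_ideal [set a | g a = 0].
Proof.
split.
- split=> [//|x y /= gx gy|b x /= gx].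
    by rewrite morphism_zmod gx gy subr0.
  by rewrite morphism_zmod gD gx addr0 subrr.
- split=> /= [|x y gx gy|b x gx]; first by rewrite circ1E.
    by rewrite gM gV gx gy -circ1E mulgV.
  by rewrite !gM gV gx -circ1E mulg1 mulgV.
- move=> b; apply/seteqP; split=> [_ [x /= gx <-]|x /= gx].
    by rewrite /lambda gD gM gx circr0 -gD addNr.
  (* The preimage of [x] under [lambda b]. *)
  exists (b^-1%g \circ (b + x)) => /=.
    by rewrite gM gV gD gx addr0 mulVg circ1E.
  by rewrite /lambda mulgA mulgV mul1g addKr.
Qed.

(** The cosets of the kernel are fibres of [v \o g], hence indexed by part of [T]. *)
Lemma kernel_quotient_finite (T : finType) (v : C -> T) :
  injective v -> finite_set (brace_quotient [set a | g a = 0]).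
Proof.
move=> v_inj; pose F (t : T) := [set b | v (g b) = t].
apply: (@sub_finite_set _ _ (range F)); last first.
  by apply: finite_image; apply: finite_finset.
move=> _ [b _ <-]; exists (v (g b)) => //.
apply/seteqP; split=> [c /= /v_inj gc|_ [x /= gx <-]]; last first.
  by rewrite /F /= gD gx addr0.
exists (c - b) => /=; first by rewrite morphism_zmod gc subrr.
by rewrite addrCA subrr addr0.
Qed.

End MorphismKernel.

(** * The matrix representation attached to a word *)

Section WordRepresentation.
Variables (X : finType) (B : abelianTwoSidedSkewBraceType) (i : X -> B).
Variables (R : pzRingType) (w : seq X).
Local Notation mx := 'M[R]_((size w).+1).

(** With [p] letters of [w] left to read, the next one has index [size w - p]; reading it leads from
    row [p] to column [p - 1]. *)
Definition letter_mx (x : X) : mx := \matrix_(p, q)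
  ((p == q.+1 :> nat) && (ohead (drop (size w - p) w) == Some x))%:R.

Variable g : {additive B -> mx}.
Hypothesis gM : forall a b, g (smul a b) = g a *m g b.
Hypothesis g00 : forall a, g a ord0 ord0 = 0.
Hypothesis g_letter : forall x, g (i x) = letter_mx x.

(* Rows are numbered by the length of the suffix of w that remains to be read,
   column 0 being the empty suffix. *)
Lemma coef_entry (M : zmodType) A c theta (k : M) t s :
    realizes i A c theta -> w = t ++ s ->
  g (theta k) (inord (size s)) ord0 = (coef A c s k)%:~R.
Proof.
move=> real_th; elim: s t k => [|x s IH] t k wE.
  rewrite /= (_ : inord 0 = ord0) ?g00//.
  by apply: val_inj; rewrite /= inordK.
have szw : (size s < size w)%N.
  by rewrite wE size_cat /= addnS ltnS leq_addl.
have letterE y j : letter_mx y (inord (size s).+1) j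
    = ((j == size s :> nat) && (x == y))%:R.
  rewrite mxE inordK ?ltnS// eqSS [size s == j]eq_sym.
  have -> : (size w - (size s).+1)%N = size t by rewrite wE size_cat /= addnK.
  by rewrite {2}wE drop_size_cat.
rewrite real_th raddf_sum summxE (bigD1 x)//= big1 ?addr0 => [|y yx].
  rewrite raddfD gM g_letter raddfMz g_letter -scaler_int mxE [X in X + _]mxE.
  rewrite (bigD1 (inord (size s)))//= big1 ?addr0 => [|j js].
    rewrite letterE inordK ?ltnS ?(ltnW szw)// !eqxx mul1r.
    (* The letter term reaches column 0 only if [size s = 0], matching [nilp s] in [coef]. *)
    rewrite (IH (rcons t x)) ?cat_rcons// mxE letterE eqxx andbT.
    by rewrite rmorphD /= rmorphMn /= mulr_natr eq_sym /nilp.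
  rewrite letterE (_ : (_ == _) = false) ?mul0r//.
  apply: contra_neqF js => /eqP js; apply: val_inj.
  by rewrite /= inordK// ltnS ltnW.
rewrite raddfD gM g_letter raddfMz g_letter -scaler_int mxE [X in X + _]mxE.
rewrite mxE letterE [x == y]eq_sym (negPf yx) andbF mulr0 addr0 big1// => j _.
by rewrite letterE [x == y]eq_sym (negPf yx) andbF mul0r.
Qed.

End WordRepresentation.

(** * A finite quotient detecting a nonzero element *)

Lemma Zp_intr_neq0 (m : nat) (z : int) :
  (1 < m)%N -> z != 0 -> (`|z| < m)%N -> z%:~R != 0 :> 'Z_m.
Proof.
move=> m1 z0 zm.
have natP : `|z|%:R != 0 :> 'Z_m.
  apply/eqP => /(congr1 (@nat_of_ord _)).
  rewrite val_Zp_nat// modn_small// => /eqP.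
  by rewrite absz_eq0 (negPf z0).
case: z natP {z0 zm} => // n natP.
by rewrite NegzE mulrNz oppr_eq0.
Qed.

Theorem corollary6p15 (X : finType) (hX : (0 < #|X|)%N)
    (B : abelianTwoSidedSkewBraceType) (i : X -> B)
    (hB : is_free_abelian_two_sided i) :
  residually_finite B.
Proof.
apply/seteqP; split=> [a aI|_ -> I [[[I0 _ _] _ _] _] //].
apply: contrapT => a_neq0; have [M [A [c [theta [k [nM real_th aE]]]]]] :=
  free_rational hX hB a.
have [w cw_neq0] : exists w, coef A c w k <> 0.
  by apply/existsNP => cw0; apply: a_neq0; rewrite aE (realizes_eq0 nM real_th).
(* Adding 2 makes [m] exceed both 1 and the absolute value of the coefficient. *)
pose m := `|coef A c w k|%N.+2.
pose R : comUnitRingType := 'Z_m.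
have cm_neq0 : (coef A c w k)%:~R != 0 :> R.
  by apply: Zp_intr_neq0; [|apply/eqP|].
have [C [v [v_inj vM rangev]]] := sub_brace
  (And3 (@mulmxA _ _ _ _ _) (@mulmxDl _ _ _ _) (@mulmxDr _ _ _ _))
  (strict_trig_subgroup R (size w).+1) (@strict_trigM _ _) (@strict_trigV _ _).
have liftP x : exists y, v y = letter_mx R w x.
  have : range v (letter_mx R w x).
    rewrite rangev => p q pq; rewrite mxE.
    by rewrite (_ : (_ == _) = false) // ltn_eqF.
  by case=> y _ <-; exists y.
have [g [[g_morph gi] _]] := hB C (fun x => sval (cid (liftP x))).
have vgB : zmod_morphism (v \o g).
  by move=> b d; rewrite /= (morphism_zmod g_morph) raddfB.
(* The kernel of [g] is an ideal of finite index, so it contains [a]. *)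
have ga0 : g a = 0.
  apply: (aI [set b | g b = 0]); split; first exact: kernel_ideal.
  exact: (kernel_quotient_finite g_morph v_inj).
move/eqP: cm_neq0; apply.
(* With empty prefix, the entry of [v (g a)] at row [size w] and column 0 is the coefficient modulo
   [m]. *)
rewrite -(@coef_entry _ _ i _ w (additive_of vgB) _ _ _
            M A c theta k [::] w)//=.
- by rewrite -aE ga0 raddf0 mxE.
- move=> b d; apply: (addrI (v (g b) + v (g d))).
  by rewrite /= -vM -g_morph.2 circE !g_morph.1 !raddfD.
- by move=> b; have : range v (v (g b)) by []; rewrite rangev; apply.
- by move=> x; rewrite gi; case: cid.
Qed.
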